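(* Let $\langle\mathbf A,\sim,\exists,\forall\rangle$ be an $MG_\sim$-algebra. The correspondence $\mathbf F_{mr}(\langle\mathbf A,\sim,\exists,\forall\rangle)\to\mathbf F_r(\langle\exists\mathbf A,\sim\rangle)$ defined by $F\mapsto F\cap\exists A$ is an order isomorphism whose inverse is given by $S\mapsto Fg_{mr}(S)$.
   Context: A Gödel algebra is a Heyting algebra $\langle A,\vee,\wedge,\to,0,1\rangle$ satisfying $(x\to y)\vee(y\to x)\approx 1$; put $\neg x:=x\to 0$. A De Morgan algebra is a bounded distributive lattice with a unary operation $\sim$ satisfying $\sim\sim x\approx x$ and $\sim(x\wedge y)\approx \sim x\vee\sim y$. A $G_\sim$-algebra $\langle \mathbf A,\sim\rangle$ is a Gödel algebra $\mathbf A$ with a unary operation $\sim$ that makes its bounded lattice reduct a De Morgan algebra and satisfies $\neg x\le\sim x$; put $\Delta x:=\neg\sim x$. An $MG_\sim$-algebra is an algebra $\langle A,\vee,\wedge,\to,\sim,\exists,\forall,0,1\rangle$ such that $\langle \mathbf A,\sim\rangle$ is a $G_\sim$-algebra and: (M1) $\forall x\to x\approx 1$; (M2) $\forall(x\to\forall y)\approx\exists x\to\forall y$; (M3) $\forall(\forall x\to y)\approx\forall x\to\forall y$; (M4) $\forall(\exists x\vee y)\approx\exists x\vee\forall y$; (Q) $\forall x\approx\ \sim\exists\sim x$. In an $MG_\sim$-algebra, $\exists A=\{\exists a:a\in A\}=\forall A$ is the universe of a subalgebra $\langle\exists\mathbf A,\sim\rangle$ of the $G_\sim$-algebra $\langle\mathbf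 A,\sim\rangle$. A filter is a nonempty up-closed subset closed under $\wedge$. A filter $F$ of a $G_\sim$-algebra is regular if $x\in F$ implies $\Delta x\in F$; $\mathbf F_r$ denotes the lattice of regular filters (ordered by inclusion). A filter $F$ of an $MG_\sim$-algebra is monadic regular if $x\in F$ implies $\Delta x\in F$ and $\forall x\in F$; $\mathbf F_{mr}$ denotes the lattice of monadic regular filters, and $Fg_{mr}(X)$ is the least monadic regular filter of $\langle\mathbf A,\sim,\exists,\forall\rangle$ containing $X\subseteq A$. *)

(* Defs.v *)
From HB Require Import structures.
From mathcomp Require Import all_boot all_order.
From mathcomp Require Import boolp classical_sets functions.

Set Implicit Arguments.
Unset Strict Implicit.
Unset Printing Implicit Defensive.

Import Order.TTheory.

Declare Scope heyting_scope.
Delimit Scope heyting_scope with H.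
Local Open Scope order_scope.
Local Open Scope heyting_scope.

HB.mixin Record TBDistrLattice_isHeyting d A of Order.TBDistrLattice d A := {
  imp : A -> A -> A;
  le_imp : forall x y z : A, (z <= imp x y) = (z `&` x <= y)
}.

#[short(type="heytingType")]
HB.structure Definition Heyting d :=
  {A of TBDistrLattice_isHeyting d A & Order.TBDistrLattice d A}.

Infix "~>" := imp (at level 55, right associativity) : heyting_scope.

Definition neg {d} {A : heytingType d} (x : A) : A := x ~> \bot.
Notation "¬ x" := (neg x) (at level 35, right associativity) : heyting_scope.

HB.mixin Record Heyting_isGodel d A of Heyting d A := {
  imp_prelinear : forall x y : A, (x ~> y) `|` (y ~> x) = \top
}.

#[short(type="godelType")]
HB.structure Definition Godel d := {A of Heyting_isGodel d A & Heyting d A}.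

HB.mixin Record TBDistrLattice_isDeMorgan d A of Order.TBDistrLattice d A := {
  dm : A -> A;
  dmK : forall x : A, dm (dm x) = x;
  dmI : forall x y : A, dm (x `&` y) = dm x `|` dm y
}.

#[short(type="deMorganType")]
HB.structure Definition DeMorgan d :=
  {A of TBDistrLattice_isDeMorgan d A & Order.TBDistrLattice d A}.

Notation "∼ x" := (dm x) (at level 35, right associativity) : heyting_scope.

HB.mixin Record isGtilde d A of Godel d A & DeMorgan d A := {
  neg_le_dm : forall x : A, ¬ x <= ∼ x
}.

#[short(type="gtildeType")]
HB.structure Definition Gtilde d :=
  {A of isGtilde d A & Godel d A & DeMorgan d A}.

Definition Delta {d} {A : gtildeType d} (x : A) : A := ¬ ∼ x.

HB.mixin Record Gtilde_isMonadic d A of Gtilde d A := {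
  qex : A -> A;
  qall : A -> A;
  monadic1 : forall x : A, qall x ~> x = \top;
  monadic2 : forall x y : A, qall (x ~> qall y) = (qex x ~> qall y);
  monadic3 : forall x y : A, qall (qall x ~> y) = (qall x ~> qall y);
  monadic4 : forall x y : A, qall (qex x `|` y) = qex x `|` qall y;
  monadicQ : forall x : A, qall x = ∼ qex (∼ x)
}.

#[short(type="mgtildeType")]
HB.structure Definition MGtilde d := {A of Gtilde_isMonadic d A & Gtilde d A}.

Section Monadic.
Context {d : Order.disp_t} {A : mgtildeType d}.
Implicit Types x y : A.

Lemma imp_topP x y : (x ~> y = \top) <-> (x <= y).
Proof.
by split=> [e|le]; [rewrite -[x]meet1x -le_imp e|apply/eqP; rewrite -le1x le_imp meet1x].
Qed.

Lemma dm_le x y : x <= y -> ∼ y <= ∼ x.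
Proof. by move/meet_idPl => e; rewrite -[in ∼ x]e dmI leUr. Qed.

Lemma dm_top : ∼ (\top : A) = \bot.
Proof. by apply/eqP; rewrite -lex0 -[\bot]dmK dm_le // lex1. Qed.

Lemma qex_dual x : qex x = ∼ qall (∼ x).
Proof. by rewrite monadicQ !dmK. Qed.

Lemma qall_le x : qall x <= x.
Proof. exact/imp_topP/monadic1. Qed.

Lemma le_qex x : x <= qex x.
Proof. by rewrite qex_dual -[leLHS]dmK dm_le // qall_le. Qed.

Lemma qall_top : qall \top = \top :> A.
Proof.
have e : qall \top ~> qall \top = \top :> A by apply/imp_topP.
by rewrite -[RHS]e -monadic3 monadic1.
Qed.

Lemma qall_mono x y : x <= y -> qall x <= qall y.
Proof.
move=> le; apply/imp_topP; rewrite -monadic3.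
by rewrite (_ : qall x ~> y = \top) ?qall_top //; apply/imp_topP/(le_trans (qall_le x)).
Qed.

Lemma qex_mono x y : x <= y -> qex x <= qex y.
Proof. by move=> le; rewrite !qex_dual dm_le // qall_mono // dm_le. Qed.

Lemma qall_qex x : qall (qex x) = qex x.
Proof.
rewrite -[qex x]joinx0 monadic4 (_ : qall \bot = \bot) //.
by apply/eqP; rewrite -lex0 qall_le.
Qed.

Lemma qex_qall x : qex (qall x) = qall x.
Proof.
have e : ∼ qall x = qex (∼ x) by rewrite monadicQ dmK.
by rewrite qex_dual e qall_qex -monadicQ.
Qed.

Lemma qall_idem x : qall (qall x) = qall x.
Proof. by rewrite -[in LHS](qex_qall x) qall_qex qex_qall. Qed.

Definition exA : {pred A} := [pred x | x \in range (qex : A -> A)].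

Lemma exAP x : reflect (exists a, qex a = x) (x \in exA).
Proof.
apply: (iffP idP) => [/set_mem[a _ <-]|[a <-]]; first by exists a.
by apply: mem_set; exists a.
Qed.

Lemma exA_qall x : x \in exA <-> qall x = x.
Proof.
split=> [/exAP[a <-]|<-]; first exact: qall_qex.
by apply/exAP; exists (qall x); rewrite qex_qall.
Qed.

Lemma exA_qex x : x \in exA <-> qex x = x.
Proof.
split=> [/exA_qall e|<-]; first by rewrite -e qex_qall.
by apply/exAP; exists x.
Qed.

Lemma exA_meet : meet_closed exA.
Proof.
move=> x y /exA_qex ex /exA_qex ey; apply/exA_qex/le_anti.
by rewrite le_qex andbT lexI -[in X in _ && (_ <= X)]ey -[in X in (_ <= X) && _]ex !qex_mono ?leIl ?leIr.
Qed.

Lemma exA_join : join_closed exA.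
Proof.
move=> x y /exA_qall ex /exA_qall ey; apply/exA_qall/le_anti.
by rewrite qall_le leUx -[in X in X <= _]ex -[in X in _ && (X <= _)]ey !qall_mono ?leUl ?leUr.
Qed.

Lemma exA_bot : \bot \in exA.
Proof. by apply/exA_qall/eqP; rewrite -lex0 qall_le. Qed.

Lemma exA_top : \top \in exA.
Proof. exact/exA_qall/qall_top. Qed.

Lemma exA_imp x y : x \in exA -> y \in exA -> x ~> y \in exA.
Proof. by move=> /exA_qall ex /exA_qall ey; apply/exA_qall; rewrite -ex monadic3 ey. Qed.

Lemma exA_dm x : x \in exA -> ∼ x \in exA.
Proof. by move=> /exA_qex ex; apply/exA_qall; rewrite monadicQ dmK ex. Qed.

Lemma exA_range_qall x : x \in exA <-> exists a, qall a = x.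
Proof.
split=> [/exA_qall e|[a <-]]; first by exists x.
exact/exA_qall/qall_idem.
Qed.

HB.instance Definition _ := Order.isMeetLatticeClosed.Build d A exA exA_meet.
HB.instance Definition _ := Order.isJoinLatticeClosed.Build d A exA exA_join.
HB.instance Definition _ := Order.isBLatticeClosed.Build d A exA exA_bot.
HB.instance Definition _ := Order.isTLatticeClosed.Build d A exA exA_top.

End Monadic.

(* The subalgebra of A with universe {qex a : a in A}; all its operations are
   the restrictions of those of A. *)
Record exalg {d} (A : mgtildeType d) :=
  Exalg { exval : A; exvalP : exval \in exA }.

Section Subalgebra.
Context {d : Order.disp_t} (A : mgtildeType d).
Local Notation B := (exalg A).

HB.instance Definition _ := [isSub for @exval d A].
HB.instance Definition _ := [Choice of B by <:].
HB.instance Definition _ := [SubChoice_isTBSubLattice of B by <: with d].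

Lemma exval_le (x y : B) : (x <= y) = (exval x <= exval y).
Proof. by []. Qed.

Lemma exval_inj : injective (@exval d A).
Proof. exact: val_inj. Qed.

Lemma exval_meet (x y : B) : exval (x `&` y) = exval x `&` exval y.
Proof. exact: Order.valI_subproof. Qed.

Lemma exval_join (x y : B) : exval (x `|` y) = exval x `|` exval y.
Proof. exact: Order.valU_subproof. Qed.

Lemma exval_bot : exval (\bot : B) = \bot.
Proof. exact: Order.val0_subproof. Qed.

Lemma exval_top : exval (\top : B) = \top.
Proof. exact: Order.val1_subproof. Qed.

Fact exalg_meetUl : @left_distributive B B Order.meet Order.join.
Proof.
by move=> x y z; apply: exval_inj; rewrite exval_meet !exval_join !exval_meet meetUl.
Qed.

HB.instance Definition _ :=
  Order.Lattice_Meet_isDistrLattice.Build d B exalg_meetUl.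

Definition exalg_imp (x y : B) : B := Exalg (exA_imp (exvalP x) (exvalP y)).
Definition exalg_dm (x : B) : B := Exalg (exA_dm (exvalP x)).

Fact exalg_le_imp (x y z : B) : (z <= exalg_imp x y) = (z `&` x <= y).
Proof. by rewrite !exval_le exval_meet le_imp. Qed.

HB.instance Definition _ := TBDistrLattice_isHeyting.Build d B exalg_le_imp.

Fact exalg_prelinear (x y : B) : (x ~> y) `|` (y ~> x) = \top.
Proof.
by apply: exval_inj; rewrite exval_join exval_top; apply: imp_prelinear.
Qed.

HB.instance Definition _ := Heyting_isGodel.Build d B exalg_prelinear.

Fact exalg_dmK (x : B) : exalg_dm (exalg_dm x) = x.
Proof. by apply: exval_inj; apply: dmK. Qed.

Fact exalg_dmI (x y : B) : exalg_dm (x `&` y) = exalg_dm x `|` exalg_dm y.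
Proof.
apply: exval_inj; rewrite exval_join.
by change (∼ exval (x `&` y) = ∼ exval x `|` ∼ exval y); rewrite exval_meet dmI.
Qed.

HB.instance Definition _ :=
  TBDistrLattice_isDeMorgan.Build d B exalg_dmK exalg_dmI.

Fact exalg_neg_le_dm (x : B) : ¬ x <= ∼ x.
Proof.
change (exval x ~> exval (\bot : B) <= ∼ exval x).
by rewrite exval_bot neg_le_dm.
Qed.

HB.instance Definition _ := isGtilde.Build d B exalg_neg_le_dm.

Lemma exval_imp (x y : B) : exval (x ~> y) = exval x ~> exval y.
Proof. by []. Qed.

Lemma exval_dm (x : B) : exval (∼ x) = ∼ exval x.
Proof. by []. Qed.

Lemma exval_Delta (x : B) : exval (Delta x) = Delta (exval x).
Proof. by rewrite /Delta /neg exval_imp exval_dm exval_bot. Qed.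

End Subalgebra.

Local Open Scope classical_set_scope.

Definition is_filter {d} {L : latticeType d} (F : set L) : Prop :=
  [/\ F !=set0,
      forall x y, F x -> x <= y -> F y
    & forall x y, F x -> F y -> F (Order.meet x y)].

Definition regular_filters {d} (A : gtildeType d) : set (set A) :=
  [set F | is_filter F /\ forall x, F x -> F (Delta x)].

Definition monadic_regular_filters {d} (A : mgtildeType d) : set (set A) :=
  [set F | is_filter F /\ forall x, F x -> F (Delta x) /\ F (qall x)].

Arguments regular_filters {d} A _.
Arguments monadic_regular_filters {d} A _.

Definition Fg_mr {d} {A : mgtildeType d} (X : set A) : set A :=
  smallest (monadic_regular_filters A) X.

Lemma filter_top {d} {L : tbLatticeType d} (F : set L) : is_filter F -> F \top.
Proof. by case=> -[x Fx] up _; apply: up Fx (lex1 _). Qed.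

Lemma Fg_mr_least {d} {A : mgtildeType d} (X : set A) :
  [/\ monadic_regular_filters A (Fg_mr X), X `<=` Fg_mr X
    & forall F, monadic_regular_filters A F -> X `<=` F -> Fg_mr X `<=` F].
Proof.
split; [|exact: sub_gen_smallest|by move=> F mF XF; apply: smallest_sub].
split; first split.
- by exists \top => F [[fF _] _]; apply: filter_top.
- by move=> x y Fx xy F mF; have [[[_ up _] _] _] := mF; apply: up xy; apply: Fx.
- move=> x y Fx Fy F mF; have [[[_ _ meetF] _] _] := mF.
  by apply: meetF; [apply: Fx|apply: Fy].
by move=> x Fx; split=> F mF; have [[_ reg] _] := mF; have [] := reg x (Fx F mF).
Qed.

(* The intersection of F with the universe of the subalgebra, as a set of
   elements of the type exalg A; see image_restr_ex. *)
Definition restr_ex {d} {A : mgtildeType d} (F : set A) : set (exalg A) :=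
  [set x | F (exval x)].

Lemma image_restr_ex {d} {A : mgtildeType d} (F : set A) :
  [set exval x | x in restr_ex F] = F `&` range qex.
Proof.
apply/seteqP; split=> [_ [x Fx <-]|x [Fx [a _ xa]]].
  by split=> //; have /exAP[a <-] := exvalP x; exists a.
have xP : x \in exA by apply/exAP; exists a.
by exists (Exalg xP).
Qed.

Definition extend_ex {d} {A : mgtildeType d} (S : set (exalg A)) : set A :=
  Fg_mr [set exval x | x in S].

(* f is an isomorphism of the poset P onto the poset Q, where P and Q carry the
   orders induced by X and Y. *)
Definition order_isomorphism {d d'} {X : porderType d} {Y : porderType d'}
    (P : set X) (Q : set Y) (f : X -> Y) : Prop :=
  set_bij P Q f /\
  (forall x y, P x -> P y -> (x <= y <-> f x <= f y)).

Definition inverse_on {X Y : Type} (P : set X) (Q : set Y)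
    (f : X -> Y) (g : Y -> X) : Prop :=
  [/\ set_fun Q P g, forall x, P x -> g (f x) = x & forall y, Q y -> f (g y) = y].

(* Main.v *)
(** The quantifier [qall] maps a monadic regular filter [F] into its trace on
    [exA], and [qall x <= x], so [F] is the up-closure of that trace.
    Conversely the up-closure in [A] of a regular filter [S] of the subalgebra
    is monadic regular, because [Delta] and [qall] are monotone and [qall]
    fixes [exA]; hence it is the monadic regular filter generated by [S], and
    its trace on [exA] is [S] as [S] is up-closed. *)
Require Import Defs.
From mathcomp Require Import all_boot all_order.
From mathcomp Require Import boolp classical_sets functions.

Import Order.TTheory.
Local Open Scope order_scope.
Local Open Scope classical_set_scope.

(** [Delta] is the composite of two order-reversing maps, [dm] and [neg]. *)
Lemma Delta_mono d (A : gtildeType d) (x y : A) :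
  x <= y -> Delta x <= Delta y.
Proof.
move=> xy; have dyx : dm y <= dm x.
  by move/meet_idPl: xy => e; rewrite -[in leRHS]e dmI leUr.
rewrite /Delta /neg le_imp; apply: le_trans (leI2 (lexx _) dyx) _.
by rewrite -le_imp.
Qed.

Section Correspondence.
Context {d : Order.disp_t} {A : mgtildeType d}.
Implicit Types (F G : set A) (S : set (exalg A)).

(** Explicit form of [extend_ex S] for regular [S]: membership comes with a witness in the
    subalgebra. *)
Definition upclosure S : set A := [set x | exists2 s, S s & exval s <= x].

Lemma upclosure_monadic_regular S :
  regular_filters (exalg A) S -> monadic_regular_filters A (upclosure S).
Proof.
case=> -[[s0 Ss0] upS meetS] DS; split; first split.
- by exists (exval s0), s0.
- by move=> x y [s Ss sx] xy; exists s => //; apply: le_trans xy.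
- move=> x y [s Ss sx] [t St ty]; exists (Order.meet s t); first exact: meetS.
  by rewrite exval_meet leI2.
- move=> x [s Ss sx]; split.
    by exists (Delta s); [exact: DS|rewrite exval_Delta; exact: Delta_mono].
  (* The same [s] lies below [qall x], because [exval s] is its own [qall]. *)
  exists s => //; have /exA_qall <- := exvalP s.
  exact: qall_mono.
Qed.

(** Leastness of [Fg_mr] gives one inclusion; the other holds as any filter containing [S] is
    up-closed. *)
Lemma extend_exE S : regular_filters (exalg A) S -> extend_ex S = upclosure S.
Proof.
move=> rS; have [[[_ up _] _] SFg least] := Fg_mr_least [set exval x | x in S].
apply/seteqP; split=> [|x [s Ss sx]].
  apply: least; first exact: upclosure_monadic_regular.
  by move=> _ [s Ss <-]; exists s.
by apply: up sx; apply: SFg; exists s.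
Qed.

Lemma restr_ex_regular F :
  monadic_regular_filters A F -> regular_filters (exalg A) (restr_ex F).
Proof.
move=> mF; have [fF rF] := mF; have [_ upF meetF] := fF.
split; first split.
- by exists \top; rewrite /restr_ex /mkset exval_top; apply: filter_top.
- by move=> x y Fx; rewrite exval_le; apply: upF.
- by move=> x y Fx Fy; rewrite /restr_ex /mkset exval_meet; apply: meetF.
- by move=> x Fx; rewrite /restr_ex /mkset exval_Delta; have [] := rF _ Fx.
Qed.

Lemma upclosure_restr_ex F :
  monadic_regular_filters A F -> upclosure (restr_ex F) = F.
Proof.
case=> -[_ upF _] rF; apply/seteqP; split=> x; first by move=> [s Fs]; apply: upF.
move=> Fx; have qx : qall x \in exA by apply/exA_qall/qall_idem.
by exists (Exalg qx); [have [] := rF _ Fx|exact: qall_le].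
Qed.

Lemma restr_ex_upclosure S :
  regular_filters (exalg A) S -> restr_ex (upclosure S) = S.
Proof.
case=> -[_ upS _] _; apply/seteqP; split=> x; last by move=> Sx; exists x.
by case=> s Ss sx; apply: upS Ss _; rewrite exval_le.
Qed.

(** Order is reflected because [upclosure] is monotone and recovers [F] and [G] from their
    traces. *)
Lemma restr_ex_le F G :
  monadic_regular_filters A F -> monadic_regular_filters A G ->
  F `<=` G <-> restr_ex F `<=` restr_ex G.
Proof.
move=> mF mG; split=> [FG x|FG]; first exact: FG.
rewrite -(upclosure_restr_ex F mF) -(upclosure_restr_ex G mG) => x [s Fs sx].
by exists s => //; apply: FG.
Qed.

End Correspondence.

(* On sets, the order used by order_isomorphism is inclusion (subsetEset). *)
Theorem theorem2p4 (d : Order.disp_t) (A : mgtildeType d) :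
  order_isomorphism (monadic_regular_filters A) (regular_filters (exalg A))
    (fun F : set A => restr_ex F) /\
  inverse_on (monadic_regular_filters A) (regular_filters (exalg A))
    (fun F : set A => restr_ex F) (fun S : set (exalg A) => extend_ex S).
Proof.
have extend_reg S : regular_filters (exalg A) S ->
    monadic_regular_filters A (extend_ex S).
  by move=> rS; rewrite extend_exE //; apply: upclosure_monadic_regular.
have restrK F : monadic_regular_filters A F -> extend_ex (restr_ex F) = F.
  by move=> mF; rewrite extend_exE ?upclosure_restr_ex //; apply: restr_ex_regular.
have extendK S : regular_filters (exalg A) S -> restr_ex (extend_ex S) = S.
  by move=> rS; rewrite extend_exE // restr_ex_upclosure.
split; last by split.
split; last by move=> F G mF mG; rewrite !subsetEset; apply: restr_ex_le.
split.
- by move=> F; apply: restr_ex_regular.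
(* Injectivity follows from the left inverse [extend_ex]. *)
- move=> F G /set_mem mF /set_mem mG e.
  by rewrite -(restrK F mF) e restrK.
- move=> S rS; exists (extend_ex S); [exact: extend_reg|exact: extendK].
Qed.
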